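(* Let $\{M(t)\}_{t\ge0}$ be a GCP which performs $k$ kinds of jumps of amplitude $1,\dots,k$ with positive rates $\lambda_1,\dots,\lambda_k$, let $p\in[0,1]$, and let $\{M_1(t)\}_{t\ge0}$ and $\{M_2(t)\}_{t\ge0}$ be the Type I split components of $\{M(t)\}_{t\ge0}$ obtained with flips of a $p$-coin. Then the split component processes $\{M_1(t)\}_{t\ge0}$ and $\{M_2(t)\}_{t\ge0}$ are independent.
   Context: A counting process is an $\mathbb{N}_0$-valued process with nondecreasing right-continuous paths. A generalized counting process (GCP) performing $k$ kinds of jumps of amplitude $1,2,\dots,k$ with positive rates $\lambda_1,\dots,\lambda_k$ is a counting process $\{M(t)\}_{t\ge0}$ with $M(0)=0$ and independent and stationary increments such that, as $h\to0^+$, $\mathrm{Pr}\{M(t+h)=n+j\mid M(t)=n\}$ equals $1-\sum_{i=1}^k\lambda_i h+o(h)$ for $j=0$, $\lambda_jh+o(h)$ for $1\le j\le k$, and $o(h)$ for $j\ge k+1$. Type I splitting with a $p$-coin: let $T_1<T_2<\cdots$ be the successive jump times of $\{M(t)\}_{t\ge0}$ and $J_1,J_2,\dots\in\{1,\dots,k\}$ the corresponding jump sizes. At each jump time $T_n$ a coin with head probability $p$ is flipped once, the flips being independent of each other and of $\{M(t)\}_{t\ge0}$; if head appears the whole jump $J_n$ is registered in $\{M_1(t)\}_{t\ge0}$, otherwise in $\{M_2(t)\}_{t\ge0}$. That is, with i.i.d. Bernoulli($p$) variables $\xi_n$ independent of $\{M(t)\}_{t\ge0}$, $M_1(t)=\sum_{n:T_n\le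 t}J_n\xi_n$ and $M_2(t)=\sum_{n:T_n\le t}J_n(1-\xi_n)$. *)

(* Defs.v *)
From HB Require Import structures.
From mathcomp Require Import all_boot all_order all_algebra finmap.
From mathcomp Require Import all_classical all_reals all_analysis.

Set Implicit Arguments.
Unset Strict Implicit.
Unset Printing Implicit Defensive.

Import Order.TTheory GRing.Theory Num.Theory numFieldNormedType.Exports.

Local Open Scope classical_set_scope.
Local Open Scope ring_scope.

(* A process with index set [D : set I] is a family [X : I -> T -> U] of which
   only the members indexed by [D] matter; processes in continuous time have
   [I := R] and [D := [set t | 0 <= t]]. *)
Definition is_process d d' (T : measurableType d) (U : measurableType d')
    (I : Type) (D : set I) (X : I -> T -> U) : Prop :=
  forall i, D i -> measurable_fun setT (X i).

Definition sigma_process d' (T : Type) (U : measurableType d')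
    (I : Type) (D : set I) (X : I -> T -> U) : set (set T) :=
  <<s [set A | exists i, D i /\ exists2 B, measurable B & A = X i @^-1` B] >>.

(* The two generated sigma-algebras are independent. Measurability is part of
   the definition because [P] is a total function on [set T], without meaning
   on nonmeasurable sets. *)
Definition independent_processes d d1 d2 (T : measurableType d) (R : realType)
    (P : probability T R) (U : measurableType d1) (V : measurableType d2)
    (I J : Type) (D : set I) (X : I -> T -> U) (E : set J) (Y : J -> T -> V)
    : Prop :=
  [/\ is_process D X, is_process E Y &
      forall A B, sigma_process D X A -> sigma_process E Y B ->
        P (A `&` B) = (P A * P B)%E].

Definition mutually_independent d d' (T : measurableType d) (R : realType)
    (P : probability T R) (U : measurableType d')
    (I : choiceType) (D : set I) (X : I -> T -> U) : Prop :=
  is_process D X /\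
  forall (J : {fset I}) (B : I -> set U), [set` J] `<=` D ->
    (forall i, measurable (B i)) ->
    P (\bigcap_(i in [set` J]) (X i @^-1` B i)) =
      (\prod_(i <- J) P (X i @^-1` B i))%E.

(* Only meaningful when [P B != 0]. *)
Definition cond_prob d (T : measurableType d) (R : realType)
    (P : probability T R) (A B : set T) : R :=
  fine (P (A `&` B)) / fine (P B).

Section CountingProcess.
Context d (T : measurableType d) (R : realType) (P : probability T R).

(* [nat] carries the discrete topology. *)
Record counting_process (M : R -> T -> nat) : Prop := CountingProcess {
  counting_measurable : is_process [set t : R | 0 <= t] M ;
  counting_nondecreasing : forall w (s t : R), 0 <= s -> s <= t ->
    (M s w <= M t w)%N ;
  counting_right_continuous : forall w (t : R), 0 <= t ->
    M s w @[s --> t^'+] --> M t w }.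

(* Truncated subtraction is exact here, by monotonicity of the paths. *)
Definition increment (M : R -> T -> nat) (s t : R) (w : T) : nat :=
  (M t w - M s w)%N.

Definition independent_increments (M : R -> T -> nat) : Prop :=
  forall (n : nat) (t : nat -> R), 0 <= t 0%N ->
    (forall i, (i < n)%N -> t i < t i.+1) ->
    mutually_independent P [set i | (i < n)%N]
      (fun i => increment M (t i) (t i.+1)).

Definition stationary_increments (M : R -> T -> nat) : Prop :=
  forall (s t h : R) (B : set nat), 0 <= s -> 0 <= t -> 0 <= h ->
    P (increment M s (s + h) @^-1` B) = P (increment M t (t + h) @^-1` B).

Definition transition_prob (M : R -> T -> nat) (t h : R) (n j : nat) : R :=
  cond_prob P [set w | M (t + h) w = (n + j)%N] [set w | M t w = n].

(* The values [lam j] are used for [1 <= j <= k] only. *)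
Record gcp (k : nat) (lam : nat -> R) (M : R -> T -> nat) : Prop := GCP {
  gcp_counting : counting_process M ;
  gcp_start : forall w, M 0 w = 0%N ;
  gcp_independent : independent_increments M ;
  gcp_stationary : stationary_increments M ;
  gcp_no_jump : forall (t : R) n, 0 <= t -> P [set w | M t w = n] != 0%E ->
    (fun h : R => transition_prob M t h n 0 -
                  (1 - (\sum_(1 <= i < k.+1) lam i) * h)) =o_ (0^'+) id ;
  gcp_jump : forall (t : R) n, 0 <= t -> P [set w | M t w = n] != 0%E ->
    forall j, (1 <= j <= k)%N ->
    (fun h : R => transition_prob M t h n j - lam j * h) =o_ (0^'+) id ;
  gcp_big_jump : forall (t : R) n, 0 <= t -> P [set w | M t w = n] != 0%E ->
    forall j, (k.+1 <= j)%N ->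
    (fun h : R => transition_prob M t h n j) =o_ (0^'+) id }.

End CountingProcess.

Section Splitting.
Context (R : realType).

Definition left_limit (f : R -> nat) (t : R) : nat := lim (f s @[s --> t^'-]).

Definition is_jump_time (f : R -> nat) (t : R) : Prop :=
  0 < t /\ left_limit f t <> f t.

(* [jump_time f n] is T_n for [n >= 1], with T_0 = 0 by convention; it is +oo
   when the path [f] has fewer than [n] jumps. *)
Fixpoint jump_time (f : R -> nat) (n : nat) : \bar R :=
  if n is m.+1 then
    ereal_inf [set t%:E | t in
      [set t : R | is_jump_time f t /\ (jump_time f m < t%:E)%E]]
  else 0%E.

(* Only meaningful when [jump_time f n] is finite. *)
Definition jump_size (f : R -> nat) (n : nat) : nat :=
  let t := fine (jump_time f n) in (f t - left_limit f t)%N.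

(* The coin flipped at T_(n+1) is [xi n], with [true] for head. The index sets
   are finite, since a nondecreasing path has at most [f t] jumps up to [t]. *)
Definition split_heads (T : Type) (M : R -> T -> nat) (xi : nat -> T -> bool)
    (t : R) (w : T) : nat :=
  \big[addn/0%N]_(n \in [set n | (jump_time (M ^~ w) n.+1 <= t%:E)%E])
    (jump_size (M ^~ w) n.+1 * xi n w)%N.

Definition split_tails (T : Type) (M : R -> T -> nat) (xi : nat -> T -> bool)
    (t : R) (w : T) : nat :=
  \big[addn/0%N]_(n \in [set n | (jump_time (M ^~ w) n.+1 <= t%:E)%E])
    (jump_size (M ^~ w) n.+1 * (1 - xi n w))%N.

End Splitting.

Definition iid_bernoulli d (T : measurableType d) (R : realType)
    (P : probability T R) (p : R) (xi : nat -> T -> bool) : Prop :=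
  mutually_independent P setT xi /\
  forall n, P [set w | xi n w = true] = p%:E.

(* Main.v *)
(* Cut time into steps of length h and keep, at each step, the increment of M
   and one coin, used only if the increment is nonzero. The pairs (increment of
   heads, increment of tails) are then independent over the steps, and within a
   step the joint law differs from the product of its marginals by at most
   (probability of a jump in the step) ^ 2 = O(h^2) in total variation. Over the
   O(1/h) steps before a fixed time, heads and tails are therefore independent
   up to O(h). As every path has finitely many jumps before a fixed time, each
   path of the discretized split components agrees with the true one at any
   given time once h is small, so the error vanishes in the limit. *)

Require Import Defs.
From HB Require Import structures.
From mathcomp Require Import all_boot all_order all_algebra finmap.
From mathcomp Require Import all_classical all_reals all_analysis.
From mathcomp Require Import zify ring lra.

Set Implicit Arguments.
Unset Strict Implicit.
Unset Printing Implicit Defensive.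

Import Order.TTheory GRing.Theory Num.Theory numFieldNormedType.Exports.
Local Open Scope classical_set_scope.
Local Open Scope ring_scope.

(** * Total variation of product laws *)

(** The obstacle is that the coin used at a step is selected by the number of nonzero steps before
    it, a random index, so independence of the pairs over the steps does not follow directly from
    that of the increments and of the coins. It is obtained by computing the exact probability of
    each pair of words of component increments: a possible pair determines which steps are nonzero,
    hence which coin each step uses, and the event becomes one on the increments intersected with
    one on an initial segment of the coins. To sum such probabilities over finitely many words,
    increments are clipped at a level depending on the event considered. This suffices because
    independence needs checking only on cylinders, which form a pi-system and prescribe finitely
    many values. The discretization also supplies the measurability of the split components, which
    is not apparent from their definition through infima of jump times. *)

Lemma norm_prodB_le (R : realFieldType) (L : nat) (a b : 'I_L -> R) :
  (forall i, 0 <= a i) -> (forall i, 0 <= b i) ->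
  `|\prod_i a i - \prod_i b i| <=
    \sum_(j < L) \prod_(i < L) (if (i < j)%N then a i else
                    if i == j then `|a i - b i| else b i).
Proof.
elim: L a b => [|L IH] a b a0 b0; first by rewrite !big_ord0 subrr normr0.
rewrite !big_ord_recl /=.
set A := \prod_(i < L) a _; set B := \prod_(i < L) b _.
(* Telescoping: exchanging the first factor in front of the tail [B] gives the term [j = 0]; the
   other terms keep [a ord0] in front and come from the induction on the tails. *)
have -> : a ord0 * A - b ord0 * B = (a ord0 - b ord0) * B + a ord0 * (A - B).
  by ring.
apply: (le_trans (ler_normD _ _)); apply: lerD.
  by rewrite normrM (@ger0_norm _ B) ?prodr_ge0.
rewrite normrM ger0_norm ?a0//.
apply: (le_trans (ler_wpM2l (a0 _) (IH _ _ _ _))) => //.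
rewrite mulr_sumr; apply: ler_sum => j _.
by rewrite big_ord_recl.
Qed.

(** Hybrid argument: in the [j]-th telescoping term the sum over words factors over the coordinates.
    Every coordinate other than [j] contributes a mass at most 1, and coordinate [j] contributes the
    distance of the two factors. *)
Lemma norm_sum_prodB_le (R : realFieldType) (S : finType) (L : nat)
    (a b : 'I_L -> S -> S -> R) :
  (forall i x y, 0 <= a i x y) -> (forall i x y, 0 <= b i x y) ->
  (forall i, \sum_x \sum_y a i x y <= 1) ->
  (forall i, \sum_x \sum_y b i x y <= 1) ->
  \sum_(u : {ffun 'I_L -> S}) \sum_(v : {ffun 'I_L -> S})
    `|\prod_i a i (u i) (v i) - \prod_i b i (u i) (v i)| <=
  \sum_j \sum_x \sum_y `|a j x y - b j x y|.
Proof.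
move=> a0 b0 a1 b1.
pose c (j i : 'I_L) x y := if (i < j)%N then a i x y else
                  if i == j then `|a i x y - b i x y| else b i x y.
have c0 j i x y : 0 <= c j i x y by rewrite /c; do 2?case: ifP.
apply: (@le_trans _ _ (\sum_(u : {ffun 'I_L -> S}) \sum_(v : {ffun 'I_L -> S})
    \sum_j \prod_i c j i (u i) (v i))).
  apply: ler_sum => u _; apply: ler_sum => v _.
  exact: norm_prodB_le.
under eq_bigr do rewrite exchange_big /=.
rewrite exchange_big /=; apply: ler_sum => j _.
have -> : \sum_(u : {ffun 'I_L -> S}) \sum_(v : {ffun 'I_L -> S})
    \prod_i c j i (u i) (v i) = \prod_i \sum_x \sum_y c j i x y.
  rewrite bigA_distr_bigA; apply: eq_bigr => u _.
  by rewrite bigA_distr_bigA.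
rewrite (bigD1 j) //= {1}/c ltnn eqxx.
rewrite ler_piMr//; first by do 2!apply: sumr_ge0 => ? _.
apply: Num.Theory.prodr_ile1 => i ij; apply/andP; split.
  by do 2!apply: sumr_ge0 => ? _.
rewrite /c; case: (i < j)%N; first exact: a1.
by move: ij => /negPf ->.
Qed.

(** The marginals of a product law are products, so the product of the two marginal masses is the
    mass of [A] times [B] under the product law with factors [s i]. Restricting the total variation
    sum to [A] and [B] only drops nonnegative terms. *)
Lemma prod_marginals_close (R : realFieldType) (S : finType) (L : nat)
    (r : 'I_L -> S -> S -> R) (F : {ffun 'I_L -> S} -> {ffun 'I_L -> S} -> R)
    (A B : pred {ffun 'I_L -> S}) :
  (forall i x y, 0 <= r i x y) -> (forall i, \sum_x \sum_y r i x y = 1) ->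
  (forall u v, F u v = \prod_i r i (u i) (v i)) ->
  `|\sum_(u | A u) \sum_(v | B v) F u v -
      (\sum_(u | A u) \sum_v F u v) * (\sum_(v | B v) \sum_u F u v)| <=
  \sum_j \sum_x \sum_y
    `|r j x y - (\sum_y' r j x y') * (\sum_x' r j x' y)|.
Proof.
move=> r0 r1 FE.
pose s i x y := (\sum_y' r i x y') * (\sum_x' r i x' y).
have s0 i x y : 0 <= s i x y by rewrite mulr_ge0// sumr_ge0.
have s1 i : \sum_x \sum_y s i x y = 1.
  rewrite /s; under eq_bigr do rewrite -mulr_sumr.
  by rewrite -mulr_suml [X in _ * X]exchange_big /= !r1 mulr1.
have -> : (\sum_(u | A u) \sum_v F u v) * (\sum_(v | B v) \sum_u F u v) =
    \sum_(u | A u) \sum_(v | B v) \prod_i s i (u i) (v i).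
  rewrite mulr_suml; apply: eq_bigr => u _.
  rewrite mulr_sumr; apply: eq_bigr => v _.
  rewrite big_split /= !bigA_distr_bigA.
  by congr (_ * _); apply: eq_bigr => w _; rewrite FE.
rewrite -[leRHS]/(\sum_j \sum_x \sum_y `|r j x y - s j x y|).
apply: (le_trans _ (norm_sum_prodB_le r0 s0 _ _)); last 2 first.
- by move=> i; rewrite r1.
- by move=> i; rewrite s1.
rewrite -sumrB; apply: le_trans (ler_norm_sum _ _ _) _.
rewrite [leRHS](bigID A) /= ler_wpDr//; first by do 2!apply: sumr_ge0 => ? _.
apply: ler_sum => u _.
under eq_bigr do rewrite FE.
rewrite -sumrB; apply: le_trans (ler_norm_sum _ _ _) _.
by rewrite [leRHS](bigID B) /= ler_wpDr// sumr_ge0.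
Qed.

(** * Jumps of integer-valued nondecreasing right-continuous paths *)

(** Also the index of the coin assigned to step [j]: each nonzero step uses up one coin, a zero step
    none. *)
Definition steps_before (x : nat -> nat) (j : nat) : nat :=
  (\sum_(i < j) (x i != 0))%N.

(** A discretized split component after [n] steps, with [c] the coins for heads and their
    complements for tails. *)
Definition weighted_sum (x c : nat -> nat) (n : nat) : nat :=
  (\sum_(j < n) x j * c (steps_before x j))%N.

Definition grid_increment (R : realType) (f : R -> nat) (h : R) (j : nat) :=
  (f (j.+1%:R * h)%R - f (j%:R * h)%R)%N.

Section StepPath.
Context (R : realType) (f : R -> nat).
Hypothesis f_nd : forall s t : R, 0 <= s -> s <= t -> (f s <= f t)%N.
Hypothesis f_rc : forall t : R, 0 <= t -> f s @[s --> t^'+] --> f t.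

Lemma right_constant (t : R) : 0 <= t ->
  exists2 e : R, 0 < e & forall s, t <= s < t + e -> f s = f t.
Proof.
move=> /f_rc/discrete_cvg/nbhs_ballP[e /= e0 He].
exists e => // s /andP[]; rewrite le_eqVlt => /predU1P[<-//|ts] se.
by apply: He => //=; rewrite /ball /= ltr_distlC; lra.
Qed.

Lemma left_limit_constant (a b : R) (v : nat) : a < b ->
  (forall s, a <= s < b -> f s = v) -> left_limit f b = v.
Proof.
move=> ab fv; apply: cvg_lim; first exact: discrete_hausdorff.
apply: cvg_near_cst; near=> s; apply: fv; apply/andP; split; last by [].
by apply: ltW; near: s; exact: nbhs_left_gt.
Unshelve. all: by end_near. Qed.

Lemma not_jump_constant (a b s : R) (v : nat) : a < s < b ->
  (forall s, a <= s < b -> f s = v) -> ~ is_jump_time f s.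
Proof.
move=> /andP[as_ sb] fv [_]; apply; rewrite fv ?(ltW as_)//.
apply: (left_limit_constant as_) => r /andP[ar rs].
by rewrite fv// ar (lt_trans rs).
Qed.

Definition next_jump (a : R) : \bar R :=
  ereal_inf [set t%:E | t in [set t : R | is_jump_time f t /\ a < t]].

(** The infimum [u] of the times from [a] on at which the path exceeds [f a] is a jump time: right
    continuity gives [f a < f u], while the path equals [f a] on [[a, u)], so that its left limit at
    [u] is [f a]. *)
Lemma next_jump_le_change (a s : R) : 0 <= a -> a <= s -> (f a < f s)%N ->
  (next_jump a <= s%:E)%E.
Proof.
move=> a0 as_ fas.
pose E := [set r | a <= r /\ (f a < f r)%N].
have Es : E s by [].
have lbE : lbound E a by move=> r [].
have hE : has_inf E by split; [exists s|exists a].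
pose u := inf E.
have au : a <= u by apply: lb_le_inf => //; exists s.
have us : u <= s by apply: ge_inf => //; exists a.
have [e e0 fu] := right_constant (le_trans a0 au).
have [r [ar far] ru] := inf_adherent e0 hE.
have ur : u <= r by apply: ge_inf => //; exists a.
have fau : (f a < f u)%N by rewrite -(fu r) ?ur.
have lt_au : a < u.
  by rewrite lt_neqAle au andbT; apply/eqP => auE; rewrite -auE ltnn in fau.
have fa x : a <= x < u -> f x = f a.
  move=> /andP[ax xu]; apply/eqP; rewrite eqn_leq (f_nd a0 ax) andbT leqNgt.
  apply/negP => fx; move: xu; apply/negP; rewrite -leNgt.
  by apply: ge_inf => //; exists a.
apply: (@le_trans _ _ u%:E); last by rewrite lee_fin.
apply: ereal_inf_lbound; exists u => //; split => //; split.
  exact: le_lt_trans lt_au.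
by rewrite (left_limit_constant lt_au fa) => fE; rewrite fE ltnn in fau.
Qed.

Lemma next_jump_constant (a s : R) : 0 <= a -> a <= s ->
  (s%:E < next_jump a)%E -> f s = f a.
Proof.
move=> a0 as_ sa; apply/eqP; rewrite eqn_leq (f_nd a0 as_) andbT leqNgt.
apply/negP => /(next_jump_le_change a0 as_).
by rewrite leNgt sa.
Qed.

Lemma next_jump_gt (a : R) : 0 <= a -> (a%:E < next_jump a)%E.
Proof.
move=> a0; have [e e0 fa] := right_constant a0.
apply: (@lt_le_trans _ _ (a + e)%:E); first by rewrite lte_fin; lra.
apply: le_ereal_inf_tmp => _ [t [jt at_] <-].
rewrite lee_fin leNgt; apply/negP => tae.
by apply: (not_jump_constant _ fa) jt; rewrite at_.
Qed.

(** The path is constant on some [[b, b + e)], so there is no jump strictly between [b] and [b + e];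
    yet the infimum [b] forces a jump before [b + e], which can only be at [b]. *)
Lemma next_jump_attained (a b : R) : 0 <= a -> next_jump a = b%:E ->
  left_limit f b = f a /\ (f a < f b)%N.
Proof.
move=> a0 ab; have := next_jump_gt a0; rewrite ab lte_fin => lt_ab.
have fa s : a <= s < b -> f s = f a.
  move=> /andP[as_ sb]; apply: next_jump_constant => //.
  by rewrite ab lte_fin.
have llb := left_limit_constant lt_ab fa.
split=> //.
have b0 : 0 <= b by lra.
have [e e0 fb] := right_constant b0.
have [_ [t [jt at_] <-]] : exists2 y, [set t%:E | t in
    [set t : R | is_jump_time f t /\ a < t]] y & (y < (b + e)%:E)%E.
  by apply: ereal_inf_lt; rewrite -/(next_jump a) ab lte_fin; lra.
rewrite lte_fin => tbe.
have bt : b <= t.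
  rewrite -lee_fin -ab; apply: ereal_inf_lbound.
  by exists t.
have {bt} tb : t = b.
  apply/eqP; rewrite eq_le bt andbT leNgt; apply/negP => lt_bt.
  by apply: (not_jump_constant _ fb) jt; rewrite lt_bt.
rewrite ltn_neqAle (f_nd a0 (ltW lt_ab)) andbT.
by apply/eqP => fE; move: jt => [_]; rewrite tb llb.
Qed.

Lemma jump_timeS (n : nat) (b : R) :
  jump_time f n = b%:E -> jump_time f n.+1 = next_jump b.
Proof.
by move=> nb; rewrite /= nb.
Qed.

Lemma jump_timeSy (n : nat) :
  jump_time f n = +oo%E -> jump_time f n.+1 = +oo%E.
Proof.
move=> ny; rewrite /= ny.
rewrite (_ : [set _ | _ in _] = set0) ?ereal_inf0//.
by apply/seteqP; split=> // _ [t [_ +] <-]; rewrite ltNge leey.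
Qed.

#[local] Arguments jump_time : simpl never.

Lemma jump_timeP (n : nat) :
  (exists2 b, 0 <= b & jump_time f n = b%:E) \/ jump_time f n = +oo%E.
Proof.
elim: n => [|n [[b b0 nb]|/jump_timeSy]]; [by left; exists 0| |by right].
have := next_jump_gt b0; rewrite -(jump_timeS nb).
case: (jump_time f n.+1) => [b'| |]; [|by right|by []].
by rewrite lte_fin => bb'; left; exists b' => //; lra.
Qed.

Lemma jump_time_le (n t : _) : (jump_time f n <= t%:E)%E ->
  exists b, [/\ 0 <= b, b <= t & jump_time f n = b%:E].
Proof.
by case: (jump_timeP n) => [[b b0 ->]|->//]; rewrite lee_fin; exists b.
Qed.

Lemma jump_time_nondecreasing (m n : nat) :
  (m <= n)%N -> (jump_time f m <= jump_time f n)%E.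
Proof.
move=> /subnK <-; elim: (n - m)%N => [|i IH]//; apply: (le_trans IH).
rewrite addSn; case: (jump_timeP (i + m)) => [[b b0 ib]|/jump_timeSy ->].
  by rewrite (jump_timeS ib) ib ltW// next_jump_gt.
exact: leey.
Qed.

Lemma jump_time_lt (m n : nat) (t : R) :
  (jump_time f m <= t%:E)%E -> (t%:E < jump_time f n)%E -> (m < n)%N.
Proof.
move=> mt tn; rewrite ltnNge; apply/negP => /jump_time_nondecreasing nm.
by have := lt_le_trans tn (le_trans nm mt); rewrite ltxx.
Qed.

(** Each jump raises an integer by at least one. This bounds the number of jumps up to [t] by [f t],
    so jump times cannot accumulate. *)
Lemma jump_time_level (n : nat) (b : R) :
  jump_time f n = b%:E -> (n <= f b)%N.
Proof.
elim: n b => // n IH b.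
case: (jump_timeP n) => [[a a0 na]|/jump_timeSy ->//].
rewrite (jump_timeS na) => /(next_jump_attained a0)[_].
exact: leq_ltn_trans (IH _ na).
Qed.

Lemma jump_time_bracket (t : R) : 0 <= t ->
  exists m, (jump_time f m <= t%:E < jump_time f m.+1)%E.
Proof.
move=> t0.
have exm : exists m, (jump_time f m <= t%:E)%E by exists 0%N; rewrite lee_fin.
have ubm m : (jump_time f m <= t%:E)%E -> (m <= f t)%N.
  move=> /jump_time_le[b [b0 bt mb]].
  exact: leq_trans (jump_time_level mb) (f_nd b0 bt).
case: (ex_maxnP exm ubm) => m mt maxm; exists m; rewrite mt andTb ltNge.
by apply/negP => /maxm; rewrite ltnn.
Qed.

Lemma jump_sizeE (n : nat) (a b : R) : 0 <= a ->
  jump_time f n = a%:E -> jump_time f n.+1 = b%:E ->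
  jump_size f n.+1 = (f b - f a)%N /\ (f a < f b)%N.
Proof.
move=> a0 na nb; have := nb; rewrite (jump_timeS na).
by move=> /(next_jump_attained a0)[ll ab]; rewrite /jump_size nb /= ll.
Qed.

Lemma fsum_jumps (t : R) (m : nat) (F : nat -> nat) :
  (jump_time f m <= t%:E < jump_time f m.+1)%E ->
  \big[addn/0%N]_(n \in [set n | (jump_time f n.+1 <= t%:E)%E]) F n =
  (\sum_(n < m) F n)%N.
Proof.
move=> /andP[mt tm]; rewrite (fsbig_ord _ _ F).
suff -> : [set n | (jump_time f n.+1 <= t%:E)%E] = `I_m by [].
apply/seteqP; split=> n /=; last first.
  by move=> /jump_time_nondecreasing /le_trans; apply.
by move=> /jump_time_lt /(_ tm).
Qed.

(* On a grid of mesh [h] finer than all gaps between the jumps up to [t], each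
   step contains at most one jump. *)
Lemma weighted_sum_grid (t h : R) (m n : nat) (c : nat -> nat) :
  0 < h -> (forall i, (i <= m)%N -> (jump_time f i + h%:E < jump_time f i.+1)%E) ->
  (jump_time f m <= t%:E)%E -> ((t + h)%:E < jump_time f m.+1)%E ->
  t < n%:R * h <= t + h ->
  weighted_sum (grid_increment f h) c n =
    (\sum_(i < m) jump_size f i.+1 * c i)%N.
Proof.
move=> h0 gap mt thm /andP[tn nth].
pose x := grid_increment f h.
(* Invariant: the nonzero steps before [j] are as many as the jumps up to time [j h], so the coin
   index of a nonzero step agrees with the index of its jump. *)
suff H j : (j <= n)%N -> let K := steps_before x j in
    (jump_time f K <= (j%:R * h)%:E < jump_time f K.+1)%E /\
    weighted_sum x c j = (\sum_(i < K) jump_size f i.+1 * c i)%N.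
  have [/andP[Kn nK] ->] := H n (leqnn n).
  suff -> : steps_before x n = m by [].
  apply/eqP; rewrite eqn_leq; apply/andP; split.
    by rewrite -ltnS; apply: jump_time_lt Kn (le_lt_trans _ thm); rewrite lee_fin.
  rewrite -ltnS; apply: jump_time_lt mt (lt_trans _ nK); rewrite lte_fin//.
elim: j => [|j IH] jn.
  rewrite /= /weighted_sum /steps_before !big_ord0 mul0r.
  by rewrite lexx (@jump_timeS 0 0)// next_jump_gt.
have [] := IH (ltnW jn).
set K := steps_before x j => /andP[Kj jK] S.
have jth : j.+1%:R * h <= t + h.
  by apply: le_trans nth; rewrite ler_pM2r// ler_nat.
have jj : j.+1%:R * h = j%:R * h + h by rewrite -natr1 mulrDl mul1r.
have [b [b0 bj Kb]] := jump_time_le Kj.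
have fj : f (j%:R * h) = f b.
  by apply: next_jump_constant => //; rewrite -(jump_timeS Kb).
have stepS : steps_before x j.+1 = (K + (x j != 0%N))%N.
  by rewrite /steps_before big_ord_recr.
have sumS : weighted_sum x c j.+1 =
    (\sum_(i < K) jump_size f i.+1 * c i + x j * c K)%N.
  by rewrite -S /weighted_sum big_ord_recr.
rewrite /= stepS sumS.
have [lt_jK|] := ltP (j.+1%:R * h)%:E (jump_time f K.+1).
  have xj : x j = 0%N.
    rewrite /x /grid_increment fj (next_jump_constant _ _ (a := b)) ?subnn//.
    - by lra.
    - by rewrite -(jump_timeS Kb).
  rewrite xj eqxx addn0 mul0n addn0; split=> //; rewrite lt_jK andbT.
  by apply: (le_trans Kj); rewrite lee_fin; lra.
move=> Kj1; have [b' [b'0 b'j Kb']] := jump_time_le Kj1.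
have [Jb bb'] := jump_sizeE b0 Kb Kb'.
have Km : (K.+1 <= m)%N.
  by rewrite -ltnS; apply: jump_time_lt Kj1 (le_lt_trans _ thm); rewrite lee_fin.
have jb' : j%:R * h < b' by rewrite -lte_fin -Kb'.
(* The jump at [b'] lies after the start of the step, so the gap hypothesis puts the following jump
   beyond the end of the step. *)
have jK2 : ((j.+1%:R * h)%:E < jump_time f K.+2)%E.
  by apply: lt_trans (gap _ Km); rewrite Kb' -EFinD lte_fin; lra.
have fj1 : f (j.+1%:R * h) = f b'.
  by apply: next_jump_constant => //; rewrite -(jump_timeS Kb').
have xj : x j = jump_size f K.+1 by rewrite /x /grid_increment fj fj1 Jb.
have -> : (x j != 0)%N by rewrite xj Jb -lt0n subn_gt0.
by rewrite addn1 big_ord_recr /= xj Kj1 jK2.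
Qed.

End StepPath.

Definition mesh (R : realType) (N : nat) : R := N.+1%:R^-1.

(** The successor selects the first grid point strictly after [t], so that a jump at [t] itself is
    counted; by right continuity nothing else happens in [(t, t + h]] once [h] is small. *)
Definition grid_index (R : realType) (t h : R) : nat := (Num.trunc (t / h)).+1.

Lemma mesh_gt0 (R : realType) (N : nat) : 0 < mesh R N.
Proof. by rewrite invr_gt0. Qed.

Lemma grid_index_itv (R : realType) (t h : R) : 0 <= t -> 0 < h ->
  t < (grid_index t h)%:R * h <= t + h.
Proof.
move=> t0 h0; have /Num.Theory.trunc_itv/andP[le_t lt_t] : 0 <= t / h.
  by rewrite divr_ge0 // ltW.
rewrite -ltr_pdivrMr// lt_t /= /grid_index -natr1 mulrDl mul1r lerD2r.
by rewrite -ler_pdivlMr.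
Qed.

Lemma near_mesh_lt (R : realType) (x : R) (y : \bar R) : (x%:E < y)%E ->
  \forall N \near \oo, (x%:E + (mesh R N)%:E < y)%E.
Proof.
case: y => [y| |] //; last by move=> _; near=> N; rewrite -EFinD ltey.
rewrite lte_fin => xy; have e0 : 0 < y - x by rewrite subr_gt0.
near=> N; rewrite -EFinD lte_fin -ltrBrDl.
by near: N; exact: (near_infty_natSinv_lt (PosNum e0)).
Unshelve. all: by end_near. Qed.

(** Only finitely many gaps matter, those up to the first jump after [t], and each is positive. The
    threshold on [N] depends on the path, hence the pathwise form of the conclusion. *)
Lemma near_fsum_jumps (R : realType) (f : R -> nat) (c : nat -> nat) (t : R) :
  (forall s t : R, 0 <= s -> s <= t -> (f s <= f t)%N) ->
  (forall t : R, 0 <= t -> f s @[s --> t^'+] --> f t) ->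
  0 <= t ->
  \forall N \near \oo,
    weighted_sum (grid_increment f (mesh R N)) c (grid_index t (mesh R N)) =
    \big[addn/0%N]_(n \in [set n | (jump_time f n.+1 <= t%:E)%E])
      (jump_size f n.+1 * c n)%N.
Proof.
move=> nd rc t0; have [m tm] := jump_time_bracket nd rc t0.
rewrite (fsum_jumps rc _ tm); move: tm => /andP[mt tm].
have gap : \forall N \near \oo, forall i : 'I_m.+1,
    (jump_time f i + (mesh R N)%:E < jump_time f i.+1)%E.
  apply: filter_forall => i.
  have /(jump_time_le rc)[b [b0 _ ib]] : (jump_time f i <= t%:E)%E.
    by apply: le_trans mt; apply: jump_time_nondecreasing => //; rewrite -ltnS.
  rewrite (jump_timeS ib) ib; apply: near_mesh_lt; exact: next_jump_gt.
near=> N; apply: (weighted_sum_grid nd rc c (mesh_gt0 R N) _ mt).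
- have gapN : forall i : 'I_m.+1,
    (jump_time f i + (mesh R N)%:E < jump_time f i.+1)%E by near: N.
  by move=> i im; apply: (gapN (Ordinal (im : i < m.+1)%N)).
- by rewrite EFinD; near: N; exact: near_mesh_lt.
- exact: grid_index_itv (mesh_gt0 R N).
Unshelve. all: by end_near. Qed.

(** * Measurability and independence *)

(** [A] is the lower limit of the sets [F n]. *)
Lemma near_eq_measurable d (T : measurableType d) (F : (set T)^nat) (A : set T) :
  (forall n, measurable (F n)) ->
  (forall w, \forall n \near \oo, F n w <-> A w) -> measurable A.
Proof.
move=> mF FA.
rewrite (_ : A = \bigcup_n \bigcap_(m in [set m | (n <= m)%N]) F m).
  apply: bigcupT_measurable => n; apply: bigcap_measurable => //.
  by exists n => /=.
apply/seteqP; split=> w.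
  by move=> Aw; have [n _ nF] := FA w; exists n => // m /nF [_ +]; apply.
have [n _ nF] := FA w => -[m _ /(_ (maxn m n))/(_ (leq_maxl _ _))].
exact: (nF _ (leq_maxr _ _)).1.
Qed.

(** Dominated convergence for indicators: [P (F n)] is squeezed between the probabilities of [lo n],
    which increases to [A], and of [up n], which decreases to [A]. *)
Lemma near_eq_cvg_measure d (T : measurableType d) (R : realType)
    (P : probability T R) (F : (set T)^nat) (A : set T) :
  (forall n, measurable (F n)) ->
  (forall w, \forall n \near \oo, F n w <-> A w) ->
  P (F n) @[n --> \oo] --> P A.
Proof.
move=> mF FA.
pose lo n := \bigcap_(m in [set m | (n <= m)%N]) F m.
pose up n := \bigcup_(m in [set m | (n <= m)%N]) F m.
have mlo n : measurable (lo n).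
  by apply: bigcap_measurable => //; exists n => /=.
have mup n : measurable (up n) by exact: bigcup_measurable.
have loE : \bigcup_n lo n = A.
  apply/seteqP; split=> w.
    have [n _ nF] := FA w => -[m _ /(_ (maxn m n))/(_ (leq_maxl _ _))].
    exact: (nF _ (leq_maxr _ _)).1.
  by move=> Aw; have [n _ nF] := FA w; exists n => // m /nF [_ +]; apply.
have upE : \bigcap_n up n = A.
  apply/seteqP; split=> w.
    by have [n _ nF] := FA w => /(_ n I)[m /nF nm /nm.1].
  move=> Aw n _; have [m _ mF'] := FA w; exists (maxn n m); first exact: leq_maxl.
  by apply: (mF' _ (leq_maxr _ _)).2.
have mA : measurable A by exact: near_eq_measurable FA.
apply: (@squeeze_cvge _ _ _ _ (P \o lo) _ (P \o up)).
- near=> n; apply/andP; split; apply: le_measure; rewrite ?inE//.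
    by move=> w; apply => /=.
  by move=> w Fw; exists n => /=.
- rewrite -loE; apply: nondecreasing_cvg_mu => //; first by rewrite loE.
  move=> m n mn; apply/subsetPset => w low k nk; apply: low => /=.
  exact: leq_trans nk.
- rewrite -upE; apply: nonincreasing_cvg_mu => //.
  + by apply: le_lt_trans (probability_le1 _ _) _; rewrite ?ltry.
  + by rewrite upE.
  move=> m n mn; apply/subsetPset => w [k nk Fk]; exists k => //=.
  exact: leq_trans nk.
Unshelve. all: by end_near. Qed.

(** Split according to the countably many values of [K]. It is applied to coins whose index is the
    random number of nonzero steps. *)
Lemma measurable_select d d' (T : measurableType d) (U : measurableType d')
    (K : T -> nat) (c : nat -> T -> U) :
  measurable_fun setT K -> (forall k, measurable_fun setT (c k)) ->
  measurable_fun setT (fun w => c (K w) w).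
Proof.
move=> mK mc _ B mB; rewrite setTI.
rewrite (_ : _ @^-1` B = \bigcup_k (K @^-1` [set k] `&` c k @^-1` B)).
  apply: bigcupT_measurable => k; apply: measurableI.
    by rewrite -[X in measurable X]setTI; exact: mK.
  by rewrite -[X in measurable X]setTI; exact: mc.
by apply/seteqP; split=> w; [exists (K w)|case=> k _ [/= ->]].
Qed.

Lemma measurable_nat_op d (T : measurableType d) (op : nat -> nat -> nat)
    (f g : T -> nat) :
  measurable_fun setT f -> measurable_fun setT g ->
  measurable_fun setT (fun w => op (f w) (g w)).
Proof.
move=> mf mg; apply: (measurable_select (c := fun a w => op a (g w)) mf) => a.
by move=> _ B _; have := mg measurableT (op a @^-1` B) I.
Qed.

Lemma measurable_steps_before d (T : measurableType d) (X : nat -> T -> nat)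
    (j : nat) :
  (forall j, measurable_fun setT (X j)) ->
  measurable_fun setT (fun w => steps_before (X ^~ w) j).
Proof.
move=> mX; elim: j => [|j IH].
  rewrite (_ : (fun _ => _) = cst 0%N)//.
  by apply/funext => w; rewrite /steps_before big_ord0.
rewrite (_ : (fun _ => _) = fun w => (fun a b => a + (b != 0))%N
    (steps_before (X ^~ w) j) (X j w)).
  exact: (measurable_nat_op (fun a b => a + (b != 0))%N).
by apply/funext => w; rewrite /steps_before big_ord_recr.
Qed.

Lemma measurable_weighted_sum d (T : measurableType d) (X c : nat -> T -> nat)
    (n : nat) :
  (forall j, measurable_fun setT (X j)) ->
  (forall j, measurable_fun setT (c j)) ->
  measurable_fun setT (fun w => weighted_sum (X ^~ w) (c ^~ w) n).
Proof.
move=> mX mc; rewrite /weighted_sum.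
elim: n => [|n IH].
  rewrite (_ : (fun _ => _) = cst 0%N)//.
  by apply/funext => w; rewrite big_ord0.
under eq_fun do rewrite big_ord_recr /=.
apply: (measurable_nat_op addn) => //.
apply: (measurable_nat_op muln) => //.
by apply: measurable_select => //; exact: measurable_steps_before.
Qed.

Lemma measure_finType d (T : measurableType d) (R : realType)
    (P : probability T R) (F : finType) (Z : T -> F) (A : pred F) :
  (forall z, measurable [set w | Z w = z]) ->
  P [set w | A (Z w)] = (\sum_(z | A z) P [set w | Z w = z])%E.
Proof.
move=> mZ; rewrite (@bigfs _ _ _ _ _ A) ?index_enum_uniq//; last first.
  by move=> z _; rewrite mem_index_enum.
rewrite -measure_fin_bigcup//; last first.
  by move=> z z' _ _ [w [/= <- <-]].
congr (P _); apply/seteqP; split=> w /=; first by exists (Z w).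
by move=> [z /= Az ->].
Qed.

(** Dynkin's argument: the measurable sets satisfying the product rule with the fixed [B] form a
    lambda-system containing the pi-system [G]. *)
Lemma sigma_algebra_product_rule d (T : measurableType d) (R : realType)
    (P : probability T R) (G : set (set T)) (B : set T) :
  setI_closed G -> G `<=` measurable -> measurable B ->
  (forall A, G A -> P (A `&` B) = (P A * P B)%E) ->
  forall A, <<s G>> A -> P (A `&` B) = (P A * P B)%E.
Proof.
move=> GI Gm mB GB.
pose H := [set A | measurable A /\ P (A `&` B) = (P A * P B)%E].
suff GH : <<s G>> `<=` H by move=> A /GH[].
apply: lambda_system_subset => //; last first.
  by move=> A GA; split; [exact: Gm|exact: GB].
split=> //.
- by split=> //; rewrite setTI probability_setT mul1e.
- move=> A A' AA' [mA hA] [mA' hA']; split; first exact: measurableD.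
  have -> : (A `\` A') `&` B = (A `&` B) `\` (A' `&` B).
    by apply/seteqP; split=> w /=; tauto.
  have PD (C C' : set T) : measurable C -> measurable C' -> C' `<=` C ->
      P (C `\` C') = (P C - P C')%E.
    move=> mC mC' CC'; rewrite measureD ?ltey_eq ?fin_num_measure//.
    by rewrite (setIidr CC').
  rewrite !PD//; [|exact: measurableI|exact: measurableI|exact: setSI].
  rewrite hA hA' muleBl// ?fin_num_measure//.
  by rewrite fin_num_adde_defr// fin_num_measure.
- move=> F ndF HF; have mF n : measurable (F n) by case: (HF n).
  split; first exact: bigcupT_measurable.
  have mFB n : measurable (F n `&` B) by exact: measurableI.
  have c1 : P (F n `&` B) @[n --> \oo] --> P ((\bigcup_n F n) `&` B).
    rewrite setI_bigcupl; apply: nondecreasing_cvg_mu => //.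
      exact: bigcupT_measurable.
    move=> m n mn; apply/subsetPset; apply: setSI.
    by apply/subsetPset; exact: ndF.
  have c2 : P (F n `&` B) @[n --> \oo] --> (P (\bigcup_n F n) * P B)%E.
    under eq_fun do rewrite (HF _).2.
    apply: cvgeZr; first by rewrite fin_num_measure.
    by apply: nondecreasing_cvg_mu => //; exact: bigcupT_measurable.
  exact: cvg_unique c1 c2.
Qed.

(** Constraints are a list of pairs (index, value) in which an index may recur, so that intersecting
    cylinders amounts to concatenating lists. Prescribing single values is enough since [nat] is
    countable. *)
Definition cylinder (T : Type) (I : eqType) (X : I -> T -> nat)
    (J : seq (I * nat)) : set T :=
  [set w | forall q, q \in J -> X q.1 w = q.2].

Definition cylinders (T : Type) (I : eqType) (D : set I) (X : I -> T -> nat) :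
    set (set T) :=
  [set A | exists2 J : seq (I * nat), (forall q, q \in J -> D q.1) &
                                      A = cylinder X J].

Lemma cylinders_setI (T : Type) (I : eqType) (D : set I) (X : I -> T -> nat) :
  setI_closed (cylinders D X).
Proof.
move=> _ _ [J1 D1 ->] [J2 D2 ->]; exists (J1 ++ J2).
  by move=> q; rewrite mem_cat => /orP[/D1|/D2].
apply/seteqP; split=> w.
  by move=> [w1 w2] q; rewrite mem_cat => /orP[/w1|/w2].
by move=> w12; split=> q qJ; apply: w12; rewrite mem_cat qJ ?orbT.
Qed.

Lemma cylinder_measurable d (T : measurableType d) (I : eqType) (D : set I)
    (X : I -> T -> nat) (J : seq (I * nat)) :
  is_process D X -> (forall q, q \in J -> D q.1) -> measurable (cylinder X J).
Proof.
move=> mX; elim: J => [|q J IH] DJ.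
  rewrite (_ : cylinder _ _ = setT)//.
  by apply/seteqP; split=> // w _ q; rewrite in_nil.
rewrite (_ : cylinder _ _ = X q.1 @^-1` [set q.2] `&` cylinder X J).
  apply: measurableI; last by apply: IH => r rJ; apply: DJ; rewrite inE rJ orbT.
  rewrite -[X in measurable X]setTI; apply: mX => //.
  by apply: DJ; rewrite mem_head.
apply/seteqP; split=> w.
  move=> Xw; split=> [|r rJ]; apply: Xw; first exact: mem_head.
  by rewrite inE rJ orbT.
by move=> [Xq XJ] r; rewrite inE => /predU1P[->//|/XJ].
Qed.

Lemma sigma_process_cylinders (T : Type) (I : eqType) (D : set I)
    (X : I -> T -> nat) :
  sigma_process D X `<=` <<s cylinders D X>>.
Proof.
apply: smallest_sub; first exact: smallest_sigma_algebra.
move=> _ [i [Di [B _ ->]]].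
rewrite (_ : _ @^-1` B = \bigcup_(a in B) cylinder X [:: (i, a)]).
  rewrite bigcup_mkcond; apply: sigma_algebra_bigcup => a.
  case: ifP => _; last exact: sigma_algebra0.
  apply: sub_sigma_algebra; exists [:: (i, a)] => //.
  by move=> q; rewrite inE => /eqP ->.
apply/seteqP; split=> w.
  by move=> BX; exists (X i w) => // q; rewrite inE => /eqP ->.
by move=> [a Ba /(_ (i, a))]; rewrite mem_head /= => ->.
Qed.

(** The product rule is extended from cylinders to the generated sigma-algebra in one argument at a
    time, the other being held fixed. *)
Lemma independent_processes_cylinders d (T : measurableType d) (R : realType)
    (P : probability T R) (I K : eqType) (D : set I) (X : I -> T -> nat)
    (E : set K) (Y : K -> T -> nat) :
  is_process D X -> is_process E Y ->
  (forall J J', (forall q, q \in J -> D q.1) -> (forall q, q \in J' -> E q.1) ->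
    P (cylinder X J `&` cylinder Y J') =
      (P (cylinder X J) * P (cylinder Y J'))%E) ->
  independent_processes P D X E Y.
Proof.
move=> mX mY XY; split=> // A B /sigma_process_cylinders sA
  /sigma_process_cylinders sB.
have cylX : cylinders D X `<=` measurable.
  by move=> _ [J DJ ->]; exact: cylinder_measurable mX DJ.
have cylY : cylinders E Y `<=` measurable.
  by move=> _ [J EJ ->]; exact: cylinder_measurable mY EJ.
have mB : measurable B.
  by move: B sB; apply: smallest_sub => //; exact: sigma_algebra_measurable.
apply: (sigma_algebra_product_rule (@cylinders_setI _ _ D X)) _ sA => //.
move=> _ [J DJ ->]; rewrite setIC muleC.
apply: (sigma_algebra_product_rule (@cylinders_setI _ _ E Y)) _ sB => //.
  exact: cylinder_measurable mX DJ.
by move=> _ [J' EJ' ->]; rewrite setIC muleC XY.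
Qed.

Lemma mutually_independent_prefix d d' (T : measurableType d) (R : realType)
    (P : probability T R) (U : measurableType d') (D : set nat)
    (X : nat -> T -> U) (n : nat) (B : nat -> set U) :
  mutually_independent P D X -> (forall i, (i < n)%N -> D i) ->
  (forall i, measurable (B i)) ->
  P [set w | forall i, (i < n)%N -> B i (X i w)] =
    (\prod_(i < n) P (X i @^-1` B i))%E.
Proof.
move=> [_ indX] Dn mB.
have Jn i : (i \in seq_fset tt (iota 0 n)) = (i < n)%N.
  by rewrite seq_fsetE mem_iota.
rewrite -(big_mkord xpredT (fun i => P (X i @^-1` B i))) /index_iota subn0.
rewrite -(undup_id (iota_uniq 0 n)) -(perm_big _ (seq_fset_perm tt (iota 0 n))).
rewrite -indX//; last by move=> i /=; rewrite Jn => /Dn.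
congr (P _); apply/seteqP; split=> w H i /=.
  by rewrite Jn => /H.
by move=> i_n; apply: H; rewrite /= Jn.
Qed.

Lemma sigma_algebra_setI (T : Type) (G : set (set T)) : setI_closed <<s G>>.
Proof.
have GC A : <<s G>> A -> <<s G>> (~` A).
  by move=> /sigma_algebraCD; rewrite setTD.
move=> A B GA GB; rewrite -[A `&` B]setCK setCI -bigcup2E; apply: (GC _).
apply: sigma_algebra_bigcup => -[|[|i]] /=; [exact: GC|exact: GC|].
exact: sigma_algebra0.
Qed.

Lemma sigma_algebra_forall_lt (T : Type) (G : set (set T)) (n : nat)
    (F : nat -> set T) :
  (forall i, (i < n)%N -> <<s G>> (F i)) ->
  <<s G>> [set w | forall i, (i < n)%N -> F i w].
Proof.
elim: n => [|n IH] GF.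
  rewrite (_ : mkset _ = setT); last by apply/seteqP; split.
  by have := sigma_algebraCD (@sigma_algebra0 T setT G); rewrite setD0.
rewrite (_ : mkset _ = [set w | forall i, (i < n)%N -> F i w] `&` F n).
  apply: sigma_algebra_setI; last exact: GF.
  by apply: IH => i i_n; apply: GF; exact: ltnW.
apply/seteqP; split=> w.
  by move=> H; split=> [i i_n|]; apply: H => //; exact: ltnW.
by move=> [H Hn] i; rewrite ltnS leq_eqVlt => /predU1P[->//|/H].
Qed.

Lemma sigma_process_preimage d' (T : Type) (U : measurableType d') (I : Type)
    (D : set I) (X : I -> T -> U) (i : I) (B : set U) :
  D i -> measurable B -> sigma_process D X (X i @^-1` B).
Proof.
by move=> Di mB; apply: sub_sigma_algebra; exists i; split=> //; exists B.
Qed.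

Lemma sigma_process_increment d (T : measurableType d) (R : realType) (D : set R)
    (M : R -> T -> nat) (s t : R) (B : set nat) :
  D s -> D t -> sigma_process D M (increment M s t @^-1` B).
Proof.
move=> Ds Dt.
rewrite (_ : _ @^-1` B = \bigcup_a (M s @^-1` [set a] `&`
    M t @^-1` [set b | B (b - a)%N])).
  apply: sigma_algebra_bigcup => a.
  by apply: sigma_algebra_setI; apply: sigma_process_preimage.
by apply/seteqP; split=> w; [move=> Bw; exists (M s w)|move=> [a _ [/= <-]]].
Qed.


(** * Splitting a discrete sequence of steps *)

(* Truncating the steps makes the alphabet finite, while sums of steps can still
   be compared with any number up to [K]; see [sum_clip_eq]. *)
Definition clip (K n : nat) : 'I_K.+2 := inord (minn n K.+1).

Lemma clipE (K n : nat) : clip K n = minn n K.+1 :> nat.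
Proof. by rewrite inordK// ltnS geq_minr. Qed.

Lemma clip_eq0 (K n : nat) : (clip K n == ord0) = (n == 0%N).
Proof. by rewrite -val_eqE /= clipE; lia. Qed.

(* The coin read off a pair of clipped components, [None] for a zero step, which
   uses up no coin. *)
Definition letter (K : nat) (x y : 'I_K.+2) : option bool :=
  if x != ord0 then Some true else if y != ord0 then Some false else None.

(** Recovers the clipped whole step from its two parts, of which splitting leaves at least one
    zero. *)
Definition either_letter (K : nat) (x y : 'I_K.+2) : 'I_K.+2 := if x == ord0 then y else x.

Definition coins (K : nat) (u v : nat -> 'I_K.+2) (L : nat) : seq bool :=
  pmap (fun j => letter (u j) (v j)) (iota 0 L).

(** A joint condition on step and coin is separated into a compatibility of [x] and [y], a condition
    on the step alone and one on the coin alone, so that independence of steps and coins can be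
    applied. When both parts are zero the coin is unconstrained. *)
Lemma clip_split (K n : nat) (b : bool) (x y : 'I_K.+2) :
  clip K (n * b) = x /\ clip K (n * (1 - b)) = y <->
  [/\ (x == ord0) || (y == ord0), clip K n = either_letter x y &
      forall c, letter x y = Some c -> b = c].
Proof.
have c0 : clip K 0 = ord0 by apply/eqP; rewrite clip_eq0.
rewrite /either_letter /letter; case: b; rewrite ?subnn ?subn0 ?muln0 ?muln1 c0.
  split=> [[<- <-]|[]].
    by rewrite eqxx orbT; case: (clip K n =P ord0) => [->|_]; split=> // c [].
  have [->|x0] := eqVneq x ord0; last by move=> /= /eqP ->.
  have [->//|y0] := eqVneq y ord0 => /= _ _ H.
  by have := H false erefl.
split=> [[<- <-]|[]].
  by rewrite eqxx; case: (clip K n =P ord0) => [->|_]; split=> // c [].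
have [->//|x0] := eqVneq x ord0 => /= _ _ H.
by have := H true erefl.
Qed.

Lemma coinsS (K : nat) (u v : nat -> 'I_K.+2) (L : nat) :
  coins u v L.+1 = coins u v L ++ seq_of_opt (letter (u L) (v L)).
Proof. by rewrite /coins -addn1 iotaD pmap_cat /=; case: letter. Qed.

(** Clipping preserves being nonzero, so the words alone reveal how many coins have been used; this
    makes the random coin index deterministic. *)
Lemma size_coins (K : nat) (u v : nat -> 'I_K.+2) (x : nat -> nat) (L : nat) :
  (forall j, (j < L)%N -> clip K (x j) = either_letter (u j) (v j)) ->
  size (coins u v L) = steps_before x L.
Proof.
elim: L => [|L IH] xL; first by rewrite /steps_before big_ord0.
rewrite coinsS size_cat IH; last by move=> j jL; apply: xL; exact: ltnW.
rewrite /steps_before big_ord_recr /=; congr addn.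
rewrite -(clip_eq0 K) xL// /either_letter /letter.
by case uL: (u L == ord0) => /=; rewrite ?uL//; case: (v L == ord0).
Qed.

Lemma coins_prefix (K : nat) (u v : nat -> 'I_K.+2) (b : nat -> bool) (L : nat) :
  (forall i, (i < size (coins u v L.+1))%N -> b i = nth false (coins u v L.+1) i) <->
  (forall i, (i < size (coins u v L))%N -> b i = nth false (coins u v L) i) /\
  (forall c, letter (u L) (v L) = Some c -> b (size (coins u v L)) = c).
Proof.
rewrite coinsS; set s := coins u v L; split=> [H|[Hs Hl] i].
  split=> [i si|c lc].
    by rewrite H ?nth_cat ?si// size_cat ltn_addr.
  by rewrite H lc ?nth_cat ?ltnn ?subnn// size_cat addn1.
rewrite size_cat nth_cat; case: (ltnP i (size s)) => [/Hs//|si].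
case lc : (letter (u L) (v L)) => [c|] /=; last by rewrite addn0 ltnNge si.
rewrite addn1 ltnS => is_.
have -> : i = size s by apply/eqP; rewrite eqn_leq is_.
by rewrite subnn /= (Hl c).
Qed.

(* The coin used at step [j] is the one numbered by the nonzero steps before
   [j]; once the steps are known it is determined by the words [u] and [v]. *)
Lemma clip_split_words (K : nat) (x : nat -> nat) (b : nat -> bool)
    (u v : nat -> 'I_K.+2) (L : nat) :
  (forall j, (j < L)%N -> clip K (x j * b (steps_before x j)) = u j /\
                          clip K (x j * (1 - b (steps_before x j))) = v j) <->
  [/\ forall j, (j < L)%N -> (u j == ord0) || (v j == ord0),
      forall j, (j < L)%N -> clip K (x j) = either_letter (u j) (v j) &
      forall i, (i < size (coins u v L))%N -> b i = nth false (coins u v L) i].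
Proof.
elim: L => [|L IH]; first by split.
split=> [H|[H1 H2 H3] j].
  have [H1 H2 H3] : [/\ forall j, (j < L)%N -> (u j == ord0) || (v j == ord0),
      forall j, (j < L)%N -> clip K (x j) = either_letter (u j) (v j) &
      forall i, (i < size (coins u v L))%N -> b i = nth false (coins u v L) i].
    by apply/IH => j jL; apply: H; exact: ltnW.
  have /clip_split[h1 h2 h3] := H L (ltnSn L).
  split.
  - by move=> j; rewrite ltnS leq_eqVlt => /predU1P[->//|/H1].
  - by move=> j; rewrite ltnS leq_eqVlt => /predU1P[->//|/H2].
  - by apply/coins_prefix; split=> //; rewrite (size_coins H2).
have H2' j' : (j' < L)%N -> clip K (x j') = either_letter (u j') (v j').
  by move=> jL; apply: H2; exact: ltnW.
have [H3' H3l] := (coins_prefix _ _ _ _).1 H3.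
rewrite ltnS leq_eqVlt => /predU1P[->|].
  by apply/clip_split; split; [exact: H1|exact: H2|rewrite -(size_coins H2')].
by move: j; apply/IH; split=> // j jL; apply: H1; exact: ltnW.
Qed.

Section CoinProduct.
Context (R : realType) (p : R).

Definition coin_weight (b : bool) : R := if b then p else 1 - p.

(** Joint law of the clipped heads and tails parts of one step whose clipped law is [q]. The default
    weight 1 belongs to the zero step, which uses no coin. *)
Definition letter_prob (K : nat) (q : 'I_K.+2 -> R) (x y : 'I_K.+2) : R :=
  if (x == ord0) || (y == ord0) then
    q (either_letter x y) * oapp coin_weight 1 (letter x y)
  else 0.

Lemma prod_coin_weight (K : nat) (u v : nat -> 'I_K.+2) (L : nat) :
  \prod_(i < size (coins u v L)) coin_weight (nth false (coins u v L) i) =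
  \prod_(j < L) oapp coin_weight 1 (letter (u j) (v j)).
Proof.
rewrite -(big_mkord xpredT (fun i => coin_weight (nth false (coins u v L) i))).
rewrite -(big_nth false xpredT) big_pmap.
by rewrite -(big_mkord xpredT (fun j => oapp coin_weight 1 (letter (u j) (v j))))
  /index_iota subn0.
Qed.

(* A step nonzero in both components is impossible under [letter_prob], and has
   probability [p (1 - p) (1 - q ord0) ^ 2] under the product of the marginals;
   the other discrepancies add up to three times this amount, and
   [4 p (1 - p) <= 1]. *)
Lemma letter_prob_marginals_close (K : nat) (q : 'I_K.+2 -> R) :
  0 <= p <= 1 -> (forall x, 0 <= q x) -> \sum_x q x = 1 ->
  [/\ forall x y, 0 <= letter_prob q x y,
      \sum_x \sum_y letter_prob q x y = 1 &
      \sum_x \sum_y `|letter_prob q x y -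
        (\sum_y' letter_prob q x y') * (\sum_x' letter_prob q x' y)| <=
      (1 - q ord0) ^+ 2].
Proof.
move=> /andP[p0 p1] q0 q1.
pose e := 1 - q ord0.
have eE : \sum_(x | x != ord0) q x = e.
  by rewrite /e -q1 [X in _ = X - _](bigD1 ord0)//= addrAC subrr add0r.
have e0 : 0 <= e by rewrite -eE sumr_ge0.
pose r := letter_prob q.
have r00 : r ord0 ord0 = 1 - e.
  by rewrite /r /letter_prob /either_letter /letter eqxx /= mulr1 /e; ring.
have r0y y : y != ord0 -> r ord0 y = (1 - p) * q y.
  by move=> y0; rewrite /r /letter_prob /either_letter /letter eqxx y0 /= mulrC.
have rx0 x : x != ord0 -> r x ord0 = p * q x.
  by move=> x0; rewrite /r /letter_prob /either_letter /letter eqxx (negPf x0) /= mulrC.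
have rxy x y : x != ord0 -> y != ord0 -> r x y = 0.
  by move=> x0 y0; rewrite /r /letter_prob (negPf x0) (negPf y0).
have s0 : \sum_y r ord0 y = 1 - p * e.
  rewrite (bigD1 ord0)//= r00 (eq_bigr _ r0y) -mulr_sumr eE; ring.
have sx x : x != ord0 -> \sum_y r x y = p * q x.
  move=> x0; rewrite (bigD1 ord0)//= rx0// big1 ?addr0// => y y0.
  exact: rxy.
have t0 : \sum_x r x ord0 = 1 - (1 - p) * e.
  rewrite (bigD1 ord0)//= r00 (eq_bigr _ rx0) -mulr_sumr eE; ring.
have ty y : y != ord0 -> \sum_x r x y = (1 - p) * q y.
  move=> y0; rewrite (bigD1 ord0)//= r0y// big1 ?addr0// => x x0.
  exact: rxy.
split.
- move=> x y; rewrite /letter_prob; case: ifP => // _; apply: mulr_ge0 => //.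
  by rewrite /letter /coin_weight; do 2?[case: ifP => //= _]; rewrite subr_ge0.
- rewrite -/r (bigD1 ord0)//= s0 (eq_bigr _ sx) -mulr_sumr eE; ring.
rewrite -/r -/e.
have pe : 0 <= p * (1 - p) * e by rewrite !mulr_ge0// subr_ge0.
rewrite (bigD1 ord0)//= (bigD1 ord0)//= s0 t0 r00.
have -> : 1 - e - (1 - p * e) * (1 - (1 - p) * e) = - (p * (1 - p) * e * e) by ring.
rewrite normrN (ger0_norm (mulr_ge0 pe e0)).
have -> : \sum_(y | y != ord0)
    `|r ord0 y - (1 - p * e) * \sum_x' r x' y| = p * (1 - p) * e * e.
  rewrite -{3}eE mulr_sumr; apply: eq_bigr => y y0; rewrite r0y// ty//.
  have -> : (1 - p) * q y - (1 - p * e) * ((1 - p) * q y) = p * (1 - p) * e * q y.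
    by ring.
  exact: ger0_norm (mulr_ge0 pe (q0 y)).
(* Two equal contributions per row: the entry [y = ord0], and the entries [y != ord0], where [r]
   vanishes and only the product of marginals remains. *)
have -> : \sum_(x | x != ord0) \sum_y
    `|r x y - (\sum_y' r x y') * \sum_x' r x' y| = (p * (1 - p) * e *+ 2) * e.
  rewrite -{2}eE mulr_sumr; apply: eq_bigr => x x0.
  rewrite (bigD1 ord0)//= sx// rx0// t0.
  have -> : p * q x - p * q x * (1 - (1 - p) * e) = p * (1 - p) * e * q x by ring.
  rewrite (ger0_norm (mulr_ge0 pe (q0 x))).
  have -> : \sum_(y | y != ord0) `|r x y - p * q x * \sum_x' r x' y| =
      p * (1 - p) * q x * e.
    rewrite -eE mulr_sumr; apply: eq_bigr => y y0.
    rewrite rxy// ty// sub0r normrN ger0_norm; first by ring.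
    by rewrite !mulr_ge0// subr_ge0.
  by ring.
apply: (@le_trans _ _ ((4 * (p * (1 - p))) * e ^+ 2)).
  by rewrite le_eqVlt; apply/orP; left; apply/eqP; ring.
rewrite ler_piMl ?sqr_ge0//; have := sqr_ge0 (2 * p - 1); lra.
Qed.

End CoinProduct.

Lemma fine_probability_finType d (T : measurableType d) (R : realType)
    (P : probability T R) (F : finType) (Z : T -> F) (A : pred F) :
  (forall z, measurable [set w | Z w = z]) ->
  fine (P [set w | A (Z w)]) = \sum_(z | A z) fine (P [set w | Z w = z]).
Proof.
by move=> mZ; rewrite measure_finType// -sum_fine// => z _; rewrite fin_num_measure.
Qed.

Section ClippedWords.
Context d (T : measurableType d) (R : realType) (P : probability T R).
Context (K L : nat) (p : R) (X : nat -> T -> nat) (xi : nat -> T -> bool).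
Hypothesis mX : forall j, measurable_fun setT (X j).
Hypothesis mxi : forall i, measurable_fun setT (xi i).
Hypothesis p01 : 0 <= p <= 1.
Hypothesis X_indep : forall B : nat -> set nat,
  P [set w | forall j, (j < L)%N -> B j (X j w)] =
    (\prod_(j < L) P (X j @^-1` B j))%E.
Hypothesis xi_law : forall n (b : nat -> bool),
  P [set w | forall i, (i < n)%N -> xi i w = b i] =
    (\prod_(i < n) coin_weight p (b i))%:E.
Hypothesis X_xi_indep : forall (B : nat -> set nat) n (b : nat -> bool),
  let EX := [set w | forall j, (j < L)%N -> B j (X j w)] in
  let Exi := [set w | forall i, (i < n)%N -> xi i w = b i] in
  P (EX `&` Exi) = (P EX * P Exi)%E.

Let coin j w := xi (steps_before (X ^~ w) j) w.

Definition heads_word (w : T) : {ffun 'I_L -> 'I_K.+2} :=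
  [ffun j : 'I_L => clip K (X j w * coin j w)].

Definition tails_word (w : T) : {ffun 'I_L -> 'I_K.+2} :=
  [ffun j : 'I_L => clip K (X j w * (1 - coin j w))].

Definition step_law (j : nat) (s : 'I_K.+2) : R :=
  fine (P (X j @^-1` [set n | clip K n = s])).

(** For compatible words, [clip_split_words] turns the event into [EX] on the steps intersected with
    [Exi] on the first [size cs] coins; these factor, and [prod_coin_weight] redistributes the coin
    factors over the steps. Incompatible words give an empty event and a zero factor. *)
Lemma words_law (u v : {ffun 'I_L -> 'I_K.+2}) :
  P [set w | heads_word w = u /\ tails_word w = v] =
    (\prod_(j < L) letter_prob p (step_law j) (u j) (v j))%:E.
Proof.
(* The words are extended to [nat] to match [coins]; the default [ord0] is never read, since only
   indices below [L] occur. *)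
pose u' j := oapp u ord0 (insub j : option 'I_L).
pose v' j := oapp v ord0 (insub j : option 'I_L).
have u'E (j : 'I_L) : u' j = u j by rewrite /u' valK.
have v'E (j : 'I_L) : v' j = v j by rewrite /v' valK.
pose cs := coins u' v' L.
pose BX j := [set n | clip K n = either_letter (u' j) (v' j)].
pose EX := [set w | forall j, (j < L)%N -> BX j (X j w)].
pose Exi := [set w | forall i, (i < size cs)%N -> xi i w = nth false cs i].
have wordsE w : heads_word w = u /\ tails_word w = v <->
    [/\ forall j, (j < L)%N -> (u' j == ord0) || (v' j == ord0), EX w & Exi w].
  rewrite -(clip_split_words (X ^~ w) (xi ^~ w) u' v' L); split.
    move=> [Hu Hv] j jL; have := u'E (Ordinal jL); have := v'E (Ordinal jL).
    by rewrite -Hu -Hv !ffunE /= => -> ->.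
  move=> H; split; apply/ffunP => j; rewrite ffunE -?u'E -?v'E.
    exact: (H j (ltn_ord j)).1.
  exact: (H j (ltn_ord j)).2.
have [uv0|] := boolP [forall j : 'I_L, (u j == ord0) || (v j == ord0)]; last first.
  rewrite negb_forall => /existsP[j uvj].
  rewrite (_ : mkset _ = set0) ?measure0; last first.
    apply/seteqP; split=> // w /wordsE[/(_ j (ltn_ord j))].
    by rewrite u'E v'E (negPf uvj).
  by rewrite (bigD1 j)//= /letter_prob (negPf uvj) mul0r.
rewrite (_ : mkset _ = EX `&` Exi); last first.
  apply/seteqP; split=> w; first by move=> /wordsE[].
  move=> [wX wxi]; apply/wordsE; split=> // j jL.
  by have := forallP uv0 (Ordinal jL); rewrite -u'E -v'E.
rewrite (X_xi_indep BX _ (nth false cs)) (X_indep BX) xi_law prod_coin_weight.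
rewrite (eq_bigr (fun j : 'I_L => (step_law j (either_letter (u j) (v j)))%:E)); last first.
  move=> j _; rewrite /step_law /BX u'E v'E fineK// fin_num_measure//.
  by rewrite -[X in measurable X]setTI; exact: mX.
rewrite prodEFin -EFinM -big_split /=; congr EFin; apply: eq_bigr => j _.
by rewrite /letter_prob (forallP uv0) u'E v'E.
Qed.

Lemma measurable_words (z : {ffun 'I_L -> 'I_K.+2} * {ffun 'I_L -> 'I_K.+2}) :
  measurable [set w | (heads_word w, tails_word w) = z].
Proof.
have mc j : measurable_fun setT (coin j).
  apply: measurable_select => //.
  exact: measurable_steps_before.
rewrite (_ : mkset _ = \bigcap_(j in [set: 'I_L])
   ([set w | heads_word w j = z.1 j] `&` [set w | tails_word w j = z.2 j])).
  apply: fin_bigcap_measurable => // j _.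
  have mh : measurable_fun setT (fun w => muln (X j w) (coin j w)).
    apply: (measurable_nat_op muln) => //.
    exact: (measurableT_comp (f := nat_of_bool)).
  have mt : measurable_fun setT (fun w => muln (X j w) (1 - coin j w)).
    apply: (measurable_nat_op muln) => //.
    exact: (measurableT_comp (f := fun b : bool => (1 - b)%N)).
  apply: measurableI.
    have := mh measurableT [set n | clip K n = z.1 j] I.
    by rewrite setTI; congr measurable; apply/seteqP; split=> w /=; rewrite ffunE.
  have := mt measurableT [set n | clip K n = z.2 j] I.
  by rewrite setTI; congr measurable; apply/seteqP; split=> w /=; rewrite ffunE.
apply/seteqP; split=> w; first by move=> /= <-.
move=> H; case: z H => z1 z2 /= H; congr pair.
  by apply/ffunP => j; have [] := H j I.
by apply/ffunP => j; have [] := H j I.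
Qed.

(** By [words_law] the pair of words has a product law, so the one-step estimates add up. As
    clipping preserves zero, [1 - step_law j ord0] is the probability that step [j] is nonzero. *)
Lemma words_almost_independent (A B : pred {ffun 'I_L -> 'I_K.+2}) :
  `|fine (P [set w | A (heads_word w) && B (tails_word w)]) -
    fine (P [set w | A (heads_word w)]) * fine (P [set w | B (tails_word w)])| <=
  \sum_(j < L) (1 - step_law j ord0) ^+ 2.
Proof.
pose F u v := fine (P [set w | heads_word w = u /\ tails_word w = v]).
have FE u v : F u v = \prod_(j < L) letter_prob p (step_law j) (u j) (v j).
  by rewrite /F words_law.
have q0 j s : 0 <= step_law j s by rewrite fine_ge0.
have q1 j : \sum_s step_law j s = 1.
  rewrite /step_law -(fine_probability_finType P (Z := clip K \o X j) predT).
    rewrite (_ : mkset _ = setT) ?probability_setT//.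
    by apply/seteqP; split.
  move=> z; have := @mX j measurableT [set n | clip K n = z] I.
  by rewrite setTI.
have PF (C : pred ({ffun 'I_L -> 'I_K.+2} * {ffun 'I_L -> 'I_K.+2})) :
    fine (P [set w | C (heads_word w, tails_word w)]) =
    \sum_(z | C z) F z.1 z.2.
  rewrite (fine_probability_finType P C measurable_words).
  apply: eq_bigr => -[u v] _; congr (fine (P _)).
  by apply/seteqP; split=> w /= [-> ->].
have -> : fine (P [set w | A (heads_word w) && B (tails_word w)]) =
    \sum_(u | A u) \sum_(v | B v) F u v.
  by rewrite (PF (fun z => A z.1 && B z.2)) pair_big.
have -> : fine (P [set w | A (heads_word w)]) = \sum_(u | A u) \sum_v F u v.
  rewrite (PF (fun z => A z.1)) pair_big_dep /=.
  by apply: eq_bigl => z; rewrite andbT.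
have -> : fine (P [set w | B (tails_word w)]) = \sum_(v | B v) \sum_u F u v.
  by rewrite (PF (fun z => B z.2)) [RHS]exchange_big [RHS]pair_big_dep /=.
have close j := letter_prob_marginals_close p01 (q0 j) (q1 j).
apply: le_trans (prod_marginals_close
  (r := fun j : 'I_L => letter_prob p (step_law j)) A B _ _ FE) _.
- by move=> j x y; have [r0 _ _] := close j; exact: r0.
- by move=> j; have [] := close j.
by apply: ler_sum => j _; have [] := close j.
Qed.

End ClippedWords.

(** * Discretization of the split components *)

Lemma near_all (I : eqType) (s : seq I) (F : set_system nat) (Q : I -> nat -> Prop) :
  Filter F -> (forall q, q \in s -> \forall N \near F, Q q N) ->
  \forall N \near F, forall q, q \in s -> Q q N.
Proof.
move=> FF; elim: s => [|q s IH] sQ; first by apply: filterE.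
have Qs : \forall N \near F, forall r, r \in s -> Q r N.
  by apply: IH => r rs; apply: sQ; rewrite inE rs orbT.
have Qq : \forall N \near F, Q q N by apply: sQ; exact: mem_head.
apply: filterS2 Qq Qs => N Nq Ns r; rewrite inE => /predU1P[->//|].
exact: Ns.
Qed.

(** Either nothing is clipped, or some [y j] exceeds [K.+1] and both sums are at least [K.+1 > a].
    Clipping at [K] would not do, as a clipped sum could then equal [a = K]. *)
Lemma sum_clip_eq (K L n a : nat) (y : nat -> nat) : (n <= L)%N -> (a <= K)%N ->
  ((\sum_(j < L | (j < n)%N) clip K (y j))%N == a) = ((\sum_(j < n) y j)%N == a).
Proof.
move=> nL aK; rewrite -(big_ord_widen _ (fun j => clip K (y j) : nat) nL).
under eq_bigr do rewrite clipE.
have [/forallP yK|] := boolP [forall j : 'I_n, (y j <= K.+1)%N].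
  by congr (_ == _); apply: eq_bigr => j _; apply/minn_idPl.
rewrite negb_forall => /existsP[j]; rewrite -ltnNge => yj.
by rewrite (bigD1 j)//= [X in _ = (X == a)](bigD1 j)//= (minn_idPr (ltnW yj)); lia.
Qed.

Lemma grid_index_le (R : realType) (s t h : R) : 0 < h -> s <= t ->
  (grid_index s h <= grid_index t h)%N.
Proof.
by move=> h0 st; rewrite ltnS; apply: Num.Theory.le_truncn; rewrite ler_pM2r// invr_gt0.
Qed.

Lemma iid_bernoulli_prefix d (T : measurableType d) (R : realType)
    (P : probability T R) (p : R) (xi : nat -> T -> bool) :
  iid_bernoulli P p xi -> forall n (b : nat -> bool),
  P [set w | forall i, (i < n)%N -> xi i w = b i] =
    (\prod_(i < n) coin_weight p (b i))%:E.
Proof.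
move=> [ind law] n b.
have -> := @mutually_independent_prefix _ _ _ _ P _ setT xi n (fun i => [set b i])
  ind (fun i _ => I) (fun i => I).
rewrite -prodEFin; apply: eq_bigr => i _; rewrite /coin_weight.
case: (b i); first exact: law.
rewrite (_ : _ @^-1` _ = ~` [set w | xi i w = true]); last first.
  by apply/seteqP; split=> w /=; case: (xi i w).
rewrite probability_setC ?law//.
by have := ind.1 i I measurableT [set true] I; rewrite setTI.
Qed.

Lemma gcp_jump_prob d (T : measurableType d) (R : realType)
    (P : probability T R) (k : nat) (lam : nat -> R) (M : R -> T -> nat) :
  gcp P k lam M ->
  exists2 C : R, 0 <= C &
    \forall h \near 0^'+, 1 - fine (P [set w | M h w = 0%N]) <= C * h.
Proof.
move=> hM; set lams := \sum_(1 <= i < k.+1) lam i.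
have M0 : [set w | M 0 w = 0%N] = setT.
  by apply/seteqP; split=> // w _; exact: gcp_start hM w.
have P0 : P [set w | M 0 w = 0%N] != 0%E by rewrite M0 probability_setT.
have := gcp_no_jump hM (lexx 0) P0.
move=> /eqoP/(_ 1 ltr01) near_o.
(* The summand 1 absorbs the remainder, bounded by [1 * h] near 0; the absolute value makes
   nonnegativity of the constant immediate. *)
exists (1 + `|lams|); first by rewrite addr_ge0.
near=> h.
have h0 : 0 < h by near: h; exact: nbhs_right_gt.
have : `|transition_prob P M 0 h 0 0 - (1 - lams * h)| <= 1 * `|h| by near: h.
rewrite /transition_prob /cond_prob M0 setIT probability_setT /= divr1 add0r.
rewrite mul1r (gtr0_norm h0) ler_norml => /andP[+ _].
have : lams * h <= `|lams| * h by rewrite ler_pM2r// ler_norm.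
rewrite mulrDl mul1r; lra.
Unshelve. all: by end_near. Qed.

Section GridSplit.
Context d (T : measurableType d) (R : realType) (M : R -> T -> nat).

(** Common form of [split_heads] and [split_tails], which are convertible to it for [c] the coins or
    their complements, so that both are approximated by the same lemmas. *)
Definition jump_sum (c : nat -> T -> nat) (t : R) (w : T) : nat :=
  \big[addn/0%N]_(n \in [set n | (jump_time (M ^~ w) n.+1 <= t%:E)%E])
    (jump_size (M ^~ w) n.+1 * c n w)%N.

Definition grid_sum (c : nat -> T -> nat) (h t : R) (w : T) : nat :=
  weighted_sum (grid_increment (M ^~ w) h) (c ^~ w) (grid_index t h).

Hypothesis M_counting : counting_process M.

Lemma measurable_grid_increment (h : R) (j : nat) : 0 < h ->
  measurable_fun setT (fun w => grid_increment (M ^~ w) h j).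
Proof.
move=> h0; have mM t : 0 <= t -> measurable_fun setT (M t).
  exact: counting_measurable M_counting t.
by apply: (measurable_nat_op subn); apply: mM; rewrite mulr_ge0// ltW.
Qed.

Lemma measurable_grid_sum (c : nat -> T -> nat) (h t : R) : 0 < h ->
  (forall n, measurable_fun setT (c n)) -> measurable_fun setT (grid_sum c h t).
Proof.
move=> h0 mc.
apply: (measurable_weighted_sum (X := fun j w => grid_increment (M ^~ w) h j)) => //.
by move=> j; exact: measurable_grid_increment.
Qed.

Lemma near_jump_sum (c : nat -> T -> nat) (t : R) (w : T) : 0 <= t ->
  \forall N \near \oo, grid_sum c (mesh R N) t w = jump_sum c t w.
Proof.
move=> t0; apply: near_fsum_jumps => //.
  by move=> r s; exact: counting_nondecreasing.
by move=> r; exact: counting_right_continuous.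
Qed.

Lemma measurable_jump_sum (c : nat -> T -> nat) :
  (forall n, measurable_fun setT (c n)) ->
  is_process [set t : R | 0 <= t] (jump_sum c).
Proof.
move=> mc t t0 _ B _; rewrite setTI.
apply: (@near_eq_measurable _ _ (fun N => grid_sum c (mesh R N) t @^-1` B)).
  move=> N; have := measurable_grid_sum t (mesh_gt0 R N) mc.
  by move=> /(_ measurableT B I); rewrite setTI.
move=> w; have := near_jump_sum c w t0; apply: filterS => N.
by rewrite /preimage /= => ->.
Qed.

Lemma near_cylinder (c : nat -> T -> nat) (J : seq (R * nat)) (w : T) :
  (forall q, q \in J -> 0 <= q.1) ->
  \forall N \near \oo,
    cylinder (grid_sum c (mesh R N)) J w <-> cylinder (jump_sum c) J w.
Proof.
move=> J0.
have : \forall N \near \oo, forall q, q \in J ->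
    grid_sum c (mesh R N) q.1 w = jump_sum c q.1 w.
  by apply: near_all => q qJ; apply: near_jump_sum => //; exact: J0.
by apply: filterS => N HN; split=> H q qJ; have := H q qJ; rewrite HN.
Qed.

End GridSplit.

Section Splitting.
Context d (T : measurableType d) (R : realType) (P : probability T R).
Context (k : nat) (lam : nat -> R) (M : R -> T -> nat) (p : R).
Context (xi : nat -> T -> bool).
Hypothesis M_gcp : gcp P k lam M.
Hypothesis p01 : 0 <= p <= 1.
Hypothesis xi_iid : iid_bernoulli P p xi.
Hypothesis xi_M_indep :
  independent_processes P (@setT nat) xi [set t : R | 0 <= t] M.

Let heads n w : nat := xi n w.
Let tails n w : nat := (1 - xi n w)%N.

Lemma grid_almost_independent (h t : R) (J J' : seq (R * nat)) : 0 < h ->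
  (forall q, q \in J -> q.1 <= t) -> (forall q, q \in J' -> q.1 <= t) ->
  `|fine (P (cylinder (grid_sum M heads h) J `&` cylinder (grid_sum M tails h) J')) -
    fine (P (cylinder (grid_sum M heads h) J)) *
    fine (P (cylinder (grid_sum M tails h) J'))| <=
  (grid_index t h)%:R * (1 - fine (P [set w | M h w = 0%N])) ^+ 2.
Proof.
move=> h0 Jt J't.
set A := cylinder _ J; set B := cylinder _ J'.
set L := grid_index t h.
(* Any bound on all the prescribed values would serve; their sum is one. *)
pose K := (\sum_(q <- J ++ J') q.2)%N.
pose X j w := grid_increment (M ^~ w) h j.
have XE j : X j = increment M (j%:R * h) (j.+1%:R * h) by [].
have h_ge0 j : 0 <= j%:R * h by rewrite mulr_ge0// ltW.
have mX j : measurable_fun setT (X j).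
  by have := measurable_grid_increment (gcp_counting M_gcp) j h0.
have [mxi _ indep] := xi_M_indep.
have X_indep (C : nat -> set nat) :
    P [set w | forall j, (j < L)%N -> C j (X j w)] =
    (\prod_(j < L) P (X j @^-1` C j))%E.
  apply: (@mutually_independent_prefix _ _ _ _ P _ [set i | (i < L)%N]) => //.
  apply: (gcp_independent M_gcp (t := fun j => j%:R * h)) => //.
  by move=> i _; rewrite ltr_pM2r// ltr_nat.
have X_xi (C : nat -> set nat) n (b : nat -> bool) :
    let EX := [set w | forall j, (j < L)%N -> C j (X j w)] in
    let Exi := [set w | forall i, (i < n)%N -> xi i w = b i] in
    P (EX `&` Exi) = (P EX * P Exi)%E.
  move=> EX Exi; rewrite setIC muleC; apply: indep.
    apply: (sigma_algebra_forall_lt (F := fun i => xi i @^-1` [set b i])) => i _.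
    exact: sigma_process_preimage.
  apply: (sigma_algebra_forall_lt (F := fun j => X j @^-1` C j)) => j _.
  exact: (@sigma_process_increment _ _ _ [set t : R | 0 <= t] _ _ _ _
    (h_ge0 j) (h_ge0 j.+1)).
have := @words_almost_independent _ T R P K L p X xi mX (fun i => mxi i I) p01
  X_indep (iid_bernoulli_prefix xi_iid) X_xi.
(* A cylinder of the discretized component, seen as a predicate on words: each constraint fixes a
   partial sum of letters, and all partial sums stop by [L] because the times are at most [t]. *)
pose inJ (s : seq (R * nat)) (u : {ffun 'I_L -> 'I_K.+2}) :=
  all (fun q => \sum_(j < L | (j < grid_index q.1 h)%N) u j == q.2)%N s.
move=> /(_ (inJ J) (inJ J')).
have inJE (c : nat -> T -> nat) (s : seq (R * nat)) (u : {ffun 'I_L -> 'I_K.+2}) w :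
    {subset s <= J ++ J'} ->
    (forall j : 'I_L, u j = clip K (X j w * c (steps_before (X ^~ w) j) w)%N) ->
    inJ s u <-> cylinder (grid_sum M c h) s w.
  move=> sJ uE.
  have qE q : q \in s -> (\sum_(j < L | (j < grid_index q.1 h)%N) u j == q.2)%N =
      (grid_sum M c h q.1 w == q.2).
    move=> /sJ qJ; under eq_bigr do rewrite uE.
    rewrite (sum_clip_eq (fun j => X j w * c (steps_before (X ^~ w) j) w)%N) //.
      apply: grid_index_le => //.
      by move: qJ; rewrite mem_cat => /orP[/Jt|/J't].
    by rewrite /K (big_rem q qJ) /= leq_addr.
  split=> [/allP H q qs|H].
    by apply/eqP; rewrite -qE// H.
  by apply/allP => q qs; rewrite qE//; apply/eqP; exact: H.
have AE w : inJ J (heads_word K L X xi w) <-> A w.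
  apply: inJE; first by move=> q; rewrite mem_cat => ->.
  by move=> j; rewrite ffunE.
have BE w : inJ J' (tails_word K L X xi w) <-> B w.
  apply: inJE; first by move=> q; rewrite mem_cat => ->; rewrite orbT.
  by move=> j; rewrite ffunE.
rewrite (_ : [set w | inJ J (heads_word K L X xi w)] = A); last first.
  by apply/seteqP; split=> w /AE.
rewrite (_ : [set w | inJ J' (tails_word K L X xi w)] = B); last first.
  by apply/seteqP; split=> w /BE.
rewrite (_ : [set w | inJ J (heads_word K L X xi w) && _] = A `&` B); last first.
  by apply/seteqP; split=> w; [move=> /andP[/AE ? /BE]|move=> [/AE ? /BE ?]; apply/andP].
move=> /le_trans; apply.
rewrite (eq_bigr (fun _ => (1 - fine (P [set w | M h w = 0%N])) ^+ 2)).
  by rewrite sumr_const card_ord mulr_natl.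
(* A step clips to zero exactly when it is zero, and stationarity moves it to [[0, h]], where the
   increment is [M h] because [M] starts at 0. *)
move=> j _; congr ((1 - fine _) ^+ 2).
rewrite (_ : _ @^-1` _ = increment M (j%:R * h) (j%:R * h + h) @^-1` [set 0%N]).
  rewrite (gcp_stationary M_gcp _ (h_ge0 j) (lexx 0) (ltW h0)) add0r.
  congr (P _); apply/seteqP; split=> w /=; by rewrite /increment (gcp_start M_gcp) subn0.
rewrite XE -natr1 mulrDl mul1r; apply/seteqP; split=> w /=.
  by move=> /eqP; rewrite clip_eq0 => /eqP.
by move=> /eqP; rewrite -(clip_eq0 K) => /eqP.
Qed.

Lemma split_cylinders (J J' : seq (R * nat)) :
  (forall q, q \in J -> 0 <= q.1) -> (forall q, q \in J' -> 0 <= q.1) ->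
  P (cylinder (jump_sum M heads) J `&` cylinder (jump_sum M tails) J') =
    (P (cylinder (jump_sum M heads) J) * P (cylinder (jump_sum M tails) J'))%E.
Proof.
move=> J0 J'0; set A := cylinder _ J; set B := cylinder _ J'.
have cM := gcp_counting M_gcp.
have [mxi _ _] := xi_M_indep.
have mheads n : measurable_fun setT (heads n).
  by apply: (measurableT_comp (f := nat_of_bool)) => //; exact: mxi.
have mtails n : measurable_fun setT (tails n).
  by apply: (measurableT_comp (f := fun b : bool => (1 - b)%N)) => //; exact: mxi.
pose A_ N := cylinder (grid_sum M heads (mesh R N)) J.
pose B_ N := cylinder (grid_sum M tails (mesh R N)) J'.
have mcyl c s N : (forall n, measurable_fun setT (c n)) ->
    measurable (cylinder (grid_sum M c (mesh R N)) s).
  move=> mc; apply: (@cylinder_measurable _ _ _ setT) => // t _.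
  exact: measurable_grid_sum (mesh_gt0 R N) mc.
have mA N : measurable (A_ N) by exact: mcyl.
have mB N : measurable (B_ N) by exact: mcyl.
have A_A w : \forall N \near \oo, A_ N w <-> A w by exact: near_cylinder.
have B_B w : \forall N \near \oo, B_ N w <-> B w by exact: near_cylinder.
have AB_AB w : \forall N \near \oo, (A_ N `&` B_ N) w <-> (A `&` B) w.
  by apply: filterS2 (A_A w) (B_B w) => N AN BN; rewrite /setI /=; tauto.
have mA' : measurable A by exact: near_eq_measurable A_A.
have mB' : measurable B by exact: near_eq_measurable B_B.
have cvgP F G : (forall N, measurable (F N)) -> measurable G ->
    (forall w, \forall N \near \oo, F N w <-> G w) ->
    fine (P (F N)) @[N --> \oo] --> fine (P G).
  move=> mF mG FG; apply: fine_cvg; rewrite fineK ?fin_num_measure//.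
  exact: near_eq_cvg_measure.
(* A common horizon: a nonnegative upper bound for all the times in both cylinders. *)
pose t := \sum_(q <- J ++ J') `|q.1|.
have t_ge0 : 0 <= t by apply: sumr_ge0.
have le_t q : q \in J ++ J' -> q.1 <= t.
  move=> qJ; rewrite /t (big_rem q qJ) /= (le_trans (ler_norm _))// lerDl.
  by apply: sumr_ge0.
have [C C0 nearC] := gcp_jump_prob M_gcp.
(* With [L] steps of length [h <= 1] one has [L h <= t + h <= t + 1], so [L (C h)^2] is at most
   [C^2 (t + 1) h]. *)
pose e N := C ^+ 2 * (t + 1) * mesh R N.
have mesh_cvg : mesh R N @[N --> \oo] --> 0.
  exact: cvg_harmonic.
have bound : \forall N \near \oo,
    `|fine (P (A_ N `&` B_ N)) - fine (P (A_ N)) * fine (P (B_ N))| <= e N.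
  have : \forall N \near \oo,
      1 - fine (P [set w | M (mesh R N) w = 0%N]) <= C * mesh R N.
    have /nbhs_ballP[r /= r0 Hr] := nearC.
    have := near_infty_natSinv_lt (PosNum r0); apply: filterS => N /= Nr.
    apply: Hr => /=; last exact: mesh_gt0.
    by rewrite /ball /= sub0r normrN gtr0_norm// mesh_gt0.
  apply: filterS => N HN.
  apply: le_trans (grid_almost_independent (t := t) (mesh_gt0 R N) _ _) _.
  - by move=> q qJ; apply: le_t; rewrite mem_cat qJ.
  - by move=> q qJ; apply: le_t; rewrite mem_cat qJ orbT.
  have h0 := mesh_gt0 R N.
  have h1 : mesh R N <= 1 by rewrite invf_le1// ler1n.
  have /andP[_ Lh] := grid_index_itv t_ge0 h0.
  set q := 1 - _ in HN *.
  have q0 : 0 <= q.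
    have mM0 : measurable [set w | M (mesh R N) w = 0%N].
      have mMh := counting_measurable cM (ltW h0 : [set t : R | 0 <= t] (mesh R N)).
      by have := mMh measurableT [set 0%N] I; rewrite setTI.
    by rewrite subr_ge0 -lee_fin fineK ?fin_num_measure// probability_le1.
  apply: (@le_trans _ _ ((grid_index t (mesh R N))%:R * (C * mesh R N) ^+ 2)).
    by rewrite ler_wpM2l// lerXn2r// nnegrE// mulr_ge0// ltW.
  have -> : (grid_index t (mesh R N))%:R * (C * mesh R N) ^+ 2 =
      C ^+ 2 * ((grid_index t (mesh R N))%:R * mesh R N) * mesh R N by ring.
  rewrite /e ler_wpM2r ?(ltW h0)// ler_wpM2l ?sqr_ge0//.
  by apply: le_trans Lh _; rewrite lerD2l.
have lim0 : fine (P (A_ N `&` B_ N)) - fine (P (A_ N)) * fine (P (B_ N))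
    @[N --> \oo] --> 0.
  have e0 : e N @[N --> \oo] --> 0.
    rewrite -(mulr0 (C ^+ 2 * (t + 1))); exact: cvgMr.
  apply: (@squeeze_cvgr _ _ _ _ (fun N => - e N) e); last exact: e0.
  - by apply: filterS bound => N; rewrite ler_norml.
  - by rewrite -oppr0; exact: cvgN.
have lim1 : fine (P (A_ N `&` B_ N)) - fine (P (A_ N)) * fine (P (B_ N))
    @[N --> \oo] --> fine (P (A `&` B)) - fine (P A) * fine (P B).
  apply: cvgB; last by apply: cvgM; exact: cvgP.
  by apply: cvgP => //; [move=> N; exact: measurableI|exact: measurableI].
(* The defect from independence of the discretized cylinders tends both to 0 and to the defect of
   the true ones. *)
have PAB := subr0_eq (cvg_unique (@norm_hausdorff _ _) lim1 lim0).
rewrite -[LHS]fineK ?fin_num_measure//; last exact: measurableI.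
by rewrite PAB EFinM !fineK// fin_num_measure.
Qed.

Lemma split_independent :
  independent_processes P [set t : R | 0 <= t] (split_heads M xi)
    [set t : R | 0 <= t] (split_tails M xi).
Proof.
have cM := gcp_counting M_gcp.
have [mxi _ _] := xi_M_indep.
apply: independent_processes_cylinders.
- apply: (measurable_jump_sum cM) => n.
  by apply: (measurableT_comp (f := nat_of_bool)) => //; exact: mxi.
- apply: (measurable_jump_sum cM) => n.
  by apply: (measurableT_comp (f := fun b : bool => (1 - b)%N)) => //; exact: mxi.
- by move=> J J' J0 J'0; exact: split_cylinders.
Qed.

End Splitting.

Theorem proposition5p2 (d : measure_display) (T : measurableType d)
    (R : realType) (P : probability T R)
    (k : nat) (lam : nat -> R) (M : R -> T -> nat)
    (p : R) (xi : nat -> T -> bool)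
    (hk : (1 <= k)%N)
    (hlam : forall j : nat, (1 <= j <= k)%N -> 0 < lam j)
    (hM : gcp P k lam M)
    (hp : 0 <= p <= 1)
    (hxi : iid_bernoulli P p xi)
    (hind : independent_processes P
              (@setT nat) xi [set t : R | 0 <= t] M) :
  independent_processes P
    [set t : R | 0 <= t] (split_heads M xi) [set t : R | 0 <= t] (split_tails M xi).
Proof. exact: split_independent hM hp hxi hind. Qed.
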